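(* Let $\mathbb{K}\subseteq\mathbb{L}$ be valued fields with the same value group $G$, where the valuation $v$ of $\mathbb{L}$ extends that of $\mathbb{K}$. Suppose that IVT holds true for every polynomial $P(X)\in\mathbb{L}[X]$ (viewed as a function $\mathbb{K}\to\mathbb{L}$). Then (i) the value group $G$ is divisible, and (ii) the residue field of the valuation of $\mathbb{K}$ is an infinite set.
   Context: A valued field is a field $\mathbb{K}$ with a non-trivial (Krull) valuation, i.e. a surjective map $v:\mathbb{K}\to G\cup\{\infty\}$, with $G$ a totally ordered abelian group written additively, $v(x)=\infty$ iff $x=0$. The residue field of $\mathbb{K}$ is $A/M$ with $A=\{x\in\mathbb{K}: v(x)\ge0\}$, $M=\{x\in\mathbb{K}: v(x)>0\}$. IVT holds for a function $f:\mathbb{K}\to\mathbb{L}$ if, whenever $a,b\in\mathbb{K}$ satisfy $v(f(a))>0$ and $v(f(b))<0$, there is $c\in\mathbb{K}$ such that $v(f(c))=0$ and $\min\{v(a),v(b)\}\le v(c)\le\max\{v(a),v(b)\}$. *)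

(* Defs.v *)
From HB Require Import structures.
From mathcomp Require Import all_boot all_order all_algebra.
From mathcomp Require Import classical_sets cardinality.

Set Implicit Arguments.
Unset Strict Implicit.
Unset Printing Implicit Defensive.

Import Order.TTheory GRing.Theory Num.Theory.
Local Open Scope ring_scope.

(* [porderZmodType] only joins an order and a group law on the same carrier;
   totality and compatibility have to be added. Totality is a field here because
   HB has no join of [Order.Total] and [Num.POrderedZmodule] below
   [Num.RealDomain]. *)
HB.mixin Record POrderedZmodule_isOrdered G of Num.POrderedZmodule G := {
  zmod_le_total : total (<=%R : rel G);
  zmod_lerD2l : forall z x y : G, x <= y -> z + x <= z + y
}.

#[short(type="orderedZmodType")]
HB.structure Definition OrderedZmodule :=
  { G of Num.POrderedZmodule G & POrderedZmodule_isOrdered G }.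

Definition divisible (G : zmodType) : Prop :=
  forall (n : nat) (g : G), (0 < n)%N -> exists h : G, h *+ n = g.

(* G with a top element added: [Some g] is the element g of G and [None] is
   infinity, which is absorbing for addition. *)
Definition extended (G : Type) : Type := option G.

Definition infinity {G : Type} : extended G := None.

Section Extended.
Variable G : orderedZmodType.

HB.instance Definition _ := Choice.copy (extended G) (option G).

Definition ext_add (x y : extended G) : extended G :=
  match x, y with
  | Some g, Some h => Some (g + h)
  | _, _ => None
  end.

Definition ext_le (x y : extended G) : bool :=
  match x, y with
  | _, None => true
  | None, Some _ => false
  | Some g, Some h => g <= h
  end.

Fact ext_addA : associative ext_add.
Proof. by move=> [x|] [y|] [z|] //=; rewrite addrA. Qed.

Fact ext_addC : commutative ext_add.
Proof. by move=> [x|] [y|] //=; rewrite addrC. Qed.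

Fact ext_add0 : left_id (Some 0) ext_add.
Proof. by move=> [x|] //=; rewrite add0r. Qed.

HB.instance Definition _ :=
  GRing.isNmodule.Build (extended G) ext_addA ext_addC ext_add0.

Fact ext_le_refl : reflexive ext_le.
Proof. by move=> [x|] //=. Qed.

Fact ext_le_anti : antisymmetric ext_le.
Proof. by move=> [x|] [y|] //= /le_anti ->. Qed.

Fact ext_le_trans : transitive ext_le.
Proof. by move=> [x|] [y|] [z|] //=; apply: le_trans. Qed.

HB.instance Definition _ := Order.Le_isPOrder.Build ring_display (extended G)
  ext_le_refl ext_le_anti ext_le_trans.

Fact ext_le_total : total (<=%R : rel (extended G)).
Proof. by move=> [x|] [y|] //; apply: zmod_le_total. Qed.

HB.instance Definition _ :=
  Order.POrder_isTotal.Build ring_display (extended G) ext_le_total.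

Lemma ext_leEfin (g h : G) : ((Some g : extended G) <= Some h) = (g <= h).
Proof. by []. Qed.

Lemma ext_le_infinity (x : extended G) : x <= infinity.
Proof. by case: x. Qed.

Lemma ext_infinity_le (x : extended G) : (infinity <= x) = (x == infinity).
Proof. by case: x. Qed.

Lemma ext_ltEfin (g h : G) : ((Some g : extended G) < Some h) = (g < h).
Proof. by rewrite !lt_def ext_leEfin. Qed.

Lemma ext_addEfin (g h : G) :
  (Some g : extended G) + (Some h : extended G) = Some (g + h).
Proof. by []. Qed.

Lemma ext_addr_infinity (x : extended G) : x + infinity = infinity.
Proof. by case: x. Qed.

End Extended.

(* Since v is surjective, the last condition says that G is not trivial. *)
Record valuation (G : orderedZmodType) (K : fieldType) := Valuation {
  valuation_fun :> K -> extended G;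
  val_surj : forall g : extended G, exists x : K, valuation_fun x = g;
  val_infinity : forall x : K, valuation_fun x = infinity <-> x = 0;
  valM : forall x y : K,
    valuation_fun (x * y) = valuation_fun x + valuation_fun y;
  valD : forall x y : K,
    Order.min (valuation_fun x) (valuation_fun y) <= valuation_fun (x + y);
  val_nontrivial : exists x : K, x != 0 /\ valuation_fun x != 0
}.

Section ValuationRing.
Variables (G : orderedZmodType) (K : fieldType) (v : valuation G K).

Lemma val0 : v 0 = infinity.
Proof. exact/val_infinity. Qed.

Lemma val1 : v 1 = 0.
Proof.
have v1 : v 1 <> infinity.
  by move/val_infinity => /eqP; rewrite oner_eq0.
have := valM v 1 1; rewrite mulr1.
case: (v 1) v1 => [g _ [] /esym/eqP|//].
by rewrite -subr_eq0 addrK => /eqP ->.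
Qed.

Lemma valN x : v (- x) = v x.
Proof.
have vN1 : v (- 1) = 0.
  have := valM v (-1) (-1); rewrite mulrNN mulr1 val1.
  case: (v (-1)) => [g [] /esym gg|//]; congr Some; apply/le_anti.
  case/orP: (zmod_le_total g 0) => g0; have := zmod_lerD2l g _ _ g0;
    by rewrite gg addr0 => ->; rewrite g0.
by rewrite -mulN1r valM vN1 add0r.
Qed.

Definition val_nneg : {pred K} := [pred x | (0 : extended G) <= v x].

Fact val_nneg_subring : subring_closed val_nneg.
Proof.
split=> [|x y|x y]; rewrite !inE ?val1 // => vx vy.
  by apply: le_trans (valD v _ _); rewrite le_min vx valN.
rewrite valM; case: (v x) (v y) vx vy => [g|] [h|] //.
rewrite !ext_leEfin => g0 h0; apply: le_trans g0 _.
by have := zmod_lerD2l g _ _ h0; rewrite addr0.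
Qed.

HB.instance Definition _ :=
  GRing.isSubringClosed.Build K val_nneg val_nneg_subring.

Definition valuation_ring : Type := {x : K | val_nneg x}.

HB.instance Definition _ := [isSub of valuation_ring for @sval K val_nneg].
HB.instance Definition _ := [Choice of valuation_ring by <:].
HB.instance Definition _ :=
  [SubChoice_isSubComNzRing of valuation_ring by <:].

Definition valuation_ideal : {pred valuation_ring} :=
  [pred x | (0 : extended G) < v (val x)].

Fact valuation_ideal_closed : idealr_closed valuation_ideal.
Proof.
split; rewrite ?inE ?rmorph0 ?rmorph1 ?val0 ?val1 ?ltxx //= => a x y.
rewrite !inE /= => vx vy; apply: lt_le_trans (valD v _ _).
rewrite lt_min vy andbT valM; have /= := valP a; rewrite /val_nneg /=.
case: (v (val a)) (v (val x)) vx => [g|] [h|] //.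
rewrite ext_leEfin !ext_ltEfin => h0 g0; apply: lt_le_trans h0 _.
by have := zmod_lerD2l h _ _ g0; rewrite addr0 addrC.
Qed.

HB.instance Definition _ :=
  isIdealr.Build valuation_ring valuation_ideal valuation_ideal_closed.

(* The quotient A/M, with its ring structure only. *)
Definition residue_field : comNzRingType := {ideal_quot valuation_ideal}.

End ValuationRing.

Definition IVT (G : orderedZmodType) (K L : fieldType)
    (vK : valuation G K) (vL : valuation G L) (f : K -> L) : Prop :=
  forall a b : K, (0 : extended G) < vL (f a) -> vL (f b) < (0 : extended G) ->
    exists c : K, vL (f c) = 0
      /\ Order.min (vK a) (vK b) <= vK c <= Order.max (vK a) (vK b).

(* Main.v *)
Require Import Defs.
From HB Require Import structures.
From mathcomp Require Import all_boot all_order all_algebra.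
From mathcomp Require Import classical_sets cardinality.

Import Order.TTheory GRing.Theory.
Local Open Scope ring_scope.

(** Polynomials over K suffice. Divisibility: with [v e = - g], IVT for
    [e X^n] between 0 and an element of very negative value yields c with
    [n v(c) = g]. Infinite residue field: if finitely many elements represented
    all residue classes, the monic polynomial having them as roots would take
    values of positive valuation on A and of negative valuation off A, so its
    valuation would change sign without ever vanishing. *)

Local Notation ext0 := (0 : extended _).

Section ExtendedTheory.
Context {G : orderedZmodType}.
Implicit Types x y z : extended G.

Lemma ext_lerD2l z x y : x <= y -> z + x <= z + y.
Proof.
case: x y z => [x|] [y|] [z|] //; rewrite ?ext_le_infinity //.
by rewrite !ext_addEfin !ext_leEfin; apply: zmod_lerD2l.
Qed.

Lemma ext_addr_le0 x y : x <= ext0 -> y <= ext0 -> x + y <= ext0.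
Proof.
by move=> x0 y0; apply: le_trans x0; rewrite -[leRHS]addr0 ext_lerD2l.
Qed.

Lemma ext_addr_lt0 x y : x < ext0 -> y <= ext0 -> x + y < ext0.
Proof.
by move=> x0 y0; apply: le_lt_trans x0; rewrite -[leRHS]addr0 ext_lerD2l.
Qed.

Lemma ext_addr_gt0 x y : ext0 < x -> ext0 <= y -> ext0 < x + y.
Proof.
by move=> x0 y0; apply: lt_le_trans x0 _; rewrite -[leLHS]addr0 ext_lerD2l.
Qed.

Lemma ext_mulrn_le0 x n : x <= ext0 -> x *+ n <= ext0.
Proof.
by move=> x0; elim: n => [|n IHn]; rewrite ?mulr0n ?mulrS ?ext_addr_le0.
Qed.

Lemma ext_mulrnE (g : G) n : (Some g : extended G) *+ n = Some (g *+ n).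
Proof. by elim: n => [|n IHn] //; rewrite !mulrS IHn. Qed.

End ExtendedTheory.

Section ValuationTheory.
Context {G : orderedZmodType} {K : fieldType} (v : valuation G K).
Implicit Types (x y : K) (n : nat).

Lemma valX x n : v (x ^+ n) = v x *+ n.
Proof.
elim: n => [|n IHn]; first by rewrite expr0 mulr0n Defs.val1.
by rewrite exprS mulrS Defs.valM IHn.
Qed.

(** Take [x] nonzero with [v x] nonzero: as [v x + v x^-1 = 0], one of [x] and [x^-1] has negative
    valuation. *)
Lemma exists_val_lt0 : exists x, v x < ext0.
Proof.
have [x [x0 vx0]] := val_nontrivial v.
have := Defs.valM v x x^-1; rewrite divff // Defs.val1 => vxV.
have [vx|vx|vx] := ltgtP (v x) ext0; first by exists x.
- exists x^-1; rewrite ltNge; apply/negP => vVx.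
  by have := ext_addr_gt0 _ _ vx vVx; rewrite -vxV ltxx.
- by rewrite vx eqxx in vx0.
Qed.

(** If [x - y] lay in the valuation ring, so would [x = (x - y) + y]. *)
Lemma val_sub_lt0 x y : v x < ext0 -> ext0 <= v y -> v (x - y) < ext0.
Proof.
rewrite !ltNge => /negP vx vy; apply/negP => vxy; apply: vx.
by have := @rpredD _ (val_nneg v) _ _ vxy vy; rewrite subrK.
Qed.

Lemma exists_val_mulrn_lt (g : G) n :
  (0 < n)%N -> exists x, (Some (- g) : extended G) + v x *+ n < ext0.
Proof.
case: n => // n _; have [t vt] := exists_val_lt0.
(* For [n >= 1] and [v x <= 0], adding the other [n - 1] copies of [v x] keeps the sum negative. *)
suff [x [vx gx]] :
    exists x, v x <= ext0 /\ (Some (- g) : extended G) + v x < ext0.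
  by exists x; rewrite mulrS addrA ext_addr_lt0 // ext_mulrn_le0.
have [g0|g0] := leP ext0 (Some g : extended G).
  exists t; split; first exact: ltW.
  rewrite addrC; apply: ext_addr_lt0 => //.
  have := ext_lerD2l (Some (- g) : extended G) _ _ g0.
  by rewrite addr0 ext_addEfin addNr.
(* Here [g < 0], and valuation [2g] leaves [- g + 2g = g]. *)
have [x vx] := val_surj v (Some (g + g)); exists x.
rewrite vx ext_addEfin addKr; split=> //.
by rewrite -ext_addEfin ext_addr_le0 ?ltW.
Qed.

Lemma finite_residue_field_reps :
  finite_set [set: residue_field v] ->
  exists s : seq K,
    [/\ forall r, r \in s -> ext0 <= v r
      & forall x, ext0 <= v x -> exists2 r, r \in s & ext0 < v (x - r)].
Proof.
move=> /finite_seqP[s sT].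
exists [seq val (repr q : valuation_ring v) | q : residue_field v <- s].
split=> [_ /mapP[q _ ->]|x vx]; first exact: valP (repr q).
pose a : valuation_ring v := Sub x vx.
pose q : residue_field v := (\pi a)%qT.
exists (val (repr q : valuation_ring v)).
  apply: map_f; have : [set` s]%classic q by rewrite -sT.
  by [].
(* The element [a] and the chosen representative of its class agree modulo the ideal. *)
have : a - repr q \in valuation_ideal (v := v).
  by rewrite Quotient.idealrBE reprK.
by [].
Qed.

(** [Q] is the product of the [X - r] over the representatives. On the valuation ring one factor has
    positive valuation and the others nonnegative; off it every factor has negative valuation. *)
Lemma finite_residue_field_poly :
  finite_set [set: residue_field v] ->
  exists Q : {poly K}, forall x,
    (ext0 <= v x -> ext0 < v Q.[x]) /\ (v x < ext0 -> v Q.[x] < ext0).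
Proof.
move=> /finite_residue_field_reps[s [s_ge0 s_rep]].
exists (\prod_(r <- s) ('X - r%:P)) => x; rewrite horner_prod.
under eq_bigr do rewrite hornerXsubC.
split=> vx.
  have [r rs vxr] := s_rep x vx.
  rewrite (big_rem r) //= Defs.valM ext_addr_gt0 // big_seq.
  apply: (@rpred_prod _ (val_nneg v)) => i /mem_rem /s_ge0 vi.
  exact: (@rpredB _ (val_nneg v)).
(* A representative of the class of 0 shows that [s] is nonempty; the empty product would have
   valuation 0. *)
have [|r rs _] := s_rep 0; first by rewrite val0.
rewrite (big_rem r) //= Defs.valM ext_addr_lt0 ?val_sub_lt0 ?s_ge0 // big_seq.
elim/big_ind: _ => [|y z vy vz|i /mem_rem /s_ge0 vi]; first by rewrite Defs.val1.
  by rewrite Defs.valM ext_addr_le0.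
by rewrite ltW ?val_sub_lt0.
Qed.

End ValuationTheory.

Theorem proposition2p11 (G : orderedZmodType) (K L : fieldType)
    (vK : valuation G K) (vL : valuation G L)
    (iota : {rmorphism K -> L})
    (vL_extends_vK : forall x : K, vL (iota x) = vK x)
    (IVT_poly : forall P : {poly L}, IVT vK vL (fun x : K => P.[iota x])) :
  divisible G /\ infinite_set [set: residue_field vK].
Proof.
have IVTK (Q : {poly K}) a b :
    ext0 < vK Q.[a] -> vK Q.[b] < ext0 -> exists c, vK Q.[c] = 0.
  rewrite -!vL_extends_vK -!horner_map => Qa Qb.
  have [c [Qc _]] := IVT_poly _ a b Qa Qb.
  by exists c; rewrite -vL_extends_vK -horner_map.
split=> [n g n0|/finite_residue_field_poly[Q Qv]].
  have [e ve] := val_surj vK (Some (- g)).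
  have vP x : vK (e *: 'X^n).[x] = (Some (- g) : extended G) + vK x *+ n.
    by rewrite hornerZ hornerXn Defs.valM valX ve.
  have [b vb] := exists_val_mulrn_lt vK g n n0.
  have [||c] := IVTK (e *: 'X^n) 0 b; rewrite vP //.
    (* Writing [n] as a successor makes [infinity *+ n] infinite; for [n = 0] it would be 0. *)
    by rewrite val0 -(prednK n0) mulrS addrCA.
  (* An infinite [vK c] would make the sum infinite instead of 0. *)
  case: (vK c) => [h|]; last by rewrite -(prednK n0) mulrS addrCA.
  rewrite ext_mulrnE => -[ngh]; exists h.
  by apply/eqP; rewrite -subr_eq0 addrC ngh.
have [b vb] := exists_val_lt0 vK.
have [||c Qc] := IVTK Q 0 b; first by apply: (Qv 0).1; rewrite val0.
  exact: (Qv b).2.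
have [vc|vc] := leP ext0 (vK c).
  by have := (Qv c).1 vc; rewrite Qc ltxx.
by have := (Qv c).2 vc; rewrite Qc ltxx.
Qed.
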